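(* Let $S\in\mathbb{R}^3$ be a fixed point, let $m>0$, let $I\subseteq\mathbb{R}$ be an interval, and let $x:I\to\mathbb{R}^3\setminus\{S\}$ be a twice differentiable motion of an object $O$ satisfying $$x''(t)=-\,m\,\frac{x(t)-S}{|x(t)-S|^3}\qquad (t\in I),$$ such that at some time $t_0\in I$ the velocity $x'(t_0)$ is nonzero and is not parallel to $x(t_0)-S$. Then $O$ moves along a conic section: there is a conic section (an ellipse, a parabola or a hyperbola) lying in some plane of $\mathbb{R}^3$ that contains $x(t)$ for every $t\in I$.
   Context: An object subject to a force directed at an unmoving object $S$ obeying an inverse square law is one whose acceleration at distance $r$ from $S$ is $m/r^2$ directed towards $S$, for a positive constant $m$. Conic sections are ellipses (circles are included as special cases of ellipses), parabolas and hyperbolas. *)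

(* Defs.v *)
From HB Require Import structures.
From mathcomp Require Import all_boot all_order all_algebra.
From mathcomp Require Import all_classical all_reals all_analysis.

Set Implicit Arguments.
Unset Strict Implicit.
Unset Printing Implicit Defensive.

Import Order.TTheory GRing.Theory Num.Theory.
Import numFieldNormedType.Exports.
Local Open Scope classical_set_scope.
Local Open Scope ring_scope.

Definition edot (R : realType) (u w : 'rV[R]_3) : R :=
  \sum_(i < 3) u ord0 i * w ord0 i.

(* The library norm [`|u|] on row vectors is the sup norm, hence this one. *)
Definition enorm (R : realType) (u : 'rV[R]_3) : R := Num.sqrt (edot u u).

(* Meant for [w != 0]. *)
Definition parallel (R : realType) (u w : 'rV[R]_3) : Prop :=
  exists k : R, u = k *: w.

(* The difference quotient is taken along points of [I] only, so this is the
   one-sided derivative at an endpoint belonging to [I]. The topology on row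
   vectors is that of the sup norm, i.e. the usual one. *)
Definition has_deriv_within (R : realType) (I : set R) (f : R -> 'rV[R]_3)
    (t : R) (l : 'rV[R]_3) : Prop :=
  (s - t)^-1 *: (f s - f t) @[s --> within I t^'] --> l.

Definition is_line (R : realType) (D : set 'rV[R]_3) : Prop :=
  exists A u : 'rV[R]_3, u != 0 /\ D = [set A + k *: u | k in [set: R]].

Definition is_plane (R : realType) (H : set 'rV[R]_3) : Prop :=
  exists A n : 'rV[R]_3, n != 0 /\ H = [set P | edot n (P - A) = 0].

Definition edist_set (R : realType) (P : 'rV[R]_3) (D : set 'rV[R]_3) : R :=
  inf [set enorm (P - Q) | Q in D].

(* [F1 = F2] is allowed and gives the circles. *)
Definition is_ellipse_in (R : realType) (H C : set 'rV[R]_3) : Prop :=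
  exists (F1 F2 : 'rV[R]_3) (a : R),
    [/\ H F1, H F2, 0 < a, enorm (F1 - F2) < 2 * a &
        C = [set P | H P /\ enorm (P - F1) + enorm (P - F2) = 2 * a]].

Definition is_parabola_in (R : realType) (H C : set 'rV[R]_3) : Prop :=
  exists (F : 'rV[R]_3) (D : set 'rV[R]_3),
    [/\ H F, is_line D, D `<=` H, ~ D F &
        C = [set P | H P /\ enorm (P - F) = edist_set P D]].

(* Both branches. *)
Definition is_hyperbola_in (R : realType) (H C : set 'rV[R]_3) : Prop :=
  exists (F1 F2 : 'rV[R]_3) (a : R),
    [/\ H F1, H F2, 0 < a, 2 * a < enorm (F1 - F2) &
        C = [set P | H P /\ `|enorm (P - F1) - enorm (P - F2)| = 2 * a]].

Definition is_conic_in (R : realType) (H C : set 'rV[R]_3) : Prop :=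
  [\/ is_ellipse_in H C, is_parabola_in H C | is_hyperbola_in H C].

(* Main.v *)
(* Write r = x - S. The angular momentum L = r × x' and the Laplace-Runge-Lenz
   vector m e = x' × L - m r / |r| have zero derivative, hence are constant. So
   the motion stays in the plane through S orthogonal to L, and taking the inner
   product of m e with r gives |r| + e.r = p with p = |L|^2 / m > 0. This is the
   equation of a conic with focus S and eccentricity |e|: for |e| <> 1 the second
   focus is S - 2 a e with a = p / (1 - |e|^2), and for |e| = 1 the directrix is
   the line of the plane through S + p e orthogonal to e. *)
Require Import Defs.
From HB Require Import structures.
From mathcomp Require Import all_boot all_order all_algebra.
From mathcomp Require Import all_classical all_reals all_analysis.
From mathcomp Require Import ring lra.

Set Implicit Arguments.
Unset Strict Implicit.
Unset Printing Implicit Defensive.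

Import Order.TTheory GRing.Theory Num.Theory.
Import numFieldNormedType.Exports.
Local Open Scope classical_set_scope.
Local Open Scope ring_scope.

(** * Calculus of derivatives relative to a subset of the line *)

Section deriv_within.
Variable R : realType.
Implicit Types (I : set R) (f g : R -> R) (t k l : R).

(** Relational, like [has_deriv_within], so that endpoints of an interval need no separate
    treatment. *)
Definition deriv_within I f t l : Prop :=
  (s - t)^-1 * (f s - f t) @[s --> within I t^'] --> l.

Lemma has_deriv_within_coord I (f : R -> 'rV[R]_3) t (l : 'rV[R]_3) i :
  has_deriv_within I f t l -> deriv_within I (fun s => f s ord0 i) t (l ord0 i).
Proof.
move=> fl; rewrite /deriv_within.
have -> : (fun s => (s - t)^-1 * (f s ord0 i - f t ord0 i)) =
    (fun M : 'rV[R]_3 => M ord0 i) \o (fun s => (s - t)^-1 *: (f s - f t)).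
  by apply/funext => s /=; rewrite !mxE.
by apply: cvg_comp; [exact: fl|exact: coord_continuous].
Qed.

Lemma deriv_within_cvg I f t l :
  deriv_within I f t l -> f s @[s --> within I t^'] --> f t.
Proof.
move=> fl.
(* The identity also holds at [s = t], where the factor [s - t] vanishes. The limit [f t] gets
   expanded as well and is then put in the form [l * 0 + f t], to match the limits of the
   factors. *)
have -> : f = fun s => (s - t)^-1 * (f s - f t) * (s - t) + f t.
  apply/funext => s; have [->|st] := eqVneq s t; first by rewrite subrr; ring.
  by field; rewrite subr_eq0.
have -> : (t - t)^-1 * (f t - f t) * (t - t) + f t = l * (t - t) + f t.
  by rewrite !subrr; ring.
apply: cvgD; last exact: cvg_cst.
apply: cvgM => //; apply: cvgB; last exact: cvg_cst.
by apply: cvg_within_filter; exact: nbhs_dnbhs.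
Qed.

Lemma eq_deriv_within I f g t k l : f =1 g -> k = l ->
  deriv_within I f t k -> deriv_within I g t l.
Proof. by move=> /funext -> ->. Qed.

Lemma deriv_within_cst I k t : deriv_within I (fun=> k) t 0.
Proof.
rewrite /deriv_within; under eq_fun do rewrite subrr mulr0; exact: cvg_cst.
Qed.

Lemma deriv_withinD I f g t k l : deriv_within I f t k -> deriv_within I g t l ->
  deriv_within I (fun s => f s + g s) t (k + l).
Proof.
move=> fk gl; rewrite /deriv_within.
have -> : (fun s => (s - t)^-1 * (f s + g s - (f t + g t))) =
    (fun s => (s - t)^-1 * (f s - f t) + (s - t)^-1 * (g s - g t)).
  by apply/funext => s; ring.
exact: cvgD.
Qed.

Lemma deriv_withinM I f g t k l : deriv_within I f t k -> deriv_within I g t l ->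
  deriv_within I (fun s => f s * g s) t (k * g t + f t * l).
Proof.
move=> fk gl; rewrite /deriv_within.
have -> : (fun s => (s - t)^-1 * (f s * g s - f t * g t)) =
    (fun s => (s - t)^-1 * (f s - f t) * g s + f t * ((s - t)^-1 * (g s - g t))).
  by apply/funext => s; ring.
apply: cvgD; apply: cvgM => //; [exact: deriv_within_cvg gl|exact: cvg_cst].
Qed.

Lemma deriv_withinN I f t k : deriv_within I f t k ->
  deriv_within I (fun s => - f s) t (- k).
Proof.
move=> fk; rewrite /deriv_within.
have -> : (fun s => (s - t)^-1 * (- f s - - f t)) =
    (fun s => - ((s - t)^-1 * (f s - f t))).
  by apply/funext => s; ring.
exact: cvgN.
Qed.

Lemma deriv_withinB I f g t k l : deriv_within I f t k -> deriv_within I g t l ->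
  deriv_within I (fun s => f s - g s) t (k - l).
Proof. by move=> fk gl; exact/deriv_withinD/deriv_withinN. Qed.

(** Meant for the reciprocal 1/|r|, with [f] the squared norm of r. Rationalizing turns the
    difference quotient of 1/√f into minus that of f divided by √f(t) √f(s) (√f(t) + √f(s)), the
    quantity [c s] below. *)
Lemma deriv_within_sqrtV I f t k : I t -> (forall s, I s -> 0 < f s) ->
  deriv_within I f t k ->
  deriv_within I (fun s => (Num.sqrt (f s))^-1) t
    (- (k / (2 * Num.sqrt (f t) ^+ 3))).
Proof.
move=> It f0 fk.
have sf0 s : I s -> 0 < Num.sqrt (f s) by move=> Is; rewrite sqrtr_gt0 f0.
pose c s := Num.sqrt (f t) * Num.sqrt (f s) * (Num.sqrt (f t) + Num.sqrt (f s)).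
have cE : c t = 2 * Num.sqrt (f t) ^+ 3 by rewrite /c; ring.
have sqrtf : Num.sqrt (f s) @[s --> within I t^'] --> Num.sqrt (f t).
  by apply: cvg_comp; [exact: deriv_within_cvg fk|exact: sqrt_continuous].
have cl : c s @[s --> within I t^'] --> c t.
  by apply: cvgM; [apply: cvgM|apply: cvgD] => //; exact: cvg_cst.
have lim : - ((s - t)^-1 * (f s - f t) / c s) @[s --> within I t^'] -->
    - (k / (2 * Num.sqrt (f t) ^+ 3)).
  rewrite -cE; apply: cvgN; apply: cvgM => //; apply: cvgV => //.
  by rewrite cE mulf_neq0// expf_neq0// gt_eqF// sf0.
(* The rationalized quotient agrees with the original one only where [f] is positive, hence the
   restriction to points of [I]. *)
apply: cvg_trans lim; apply: near_eq_cvg.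
rewrite near_withinE; apply: nearW => s Is.
have := sf0 _ Is; have := sf0 _ It.
have {2}-> : f s = Num.sqrt (f s) ^+ 2 by rewrite sqr_sqrtr// ltW// f0.
have {2}-> : f t = Num.sqrt (f t) ^+ 2 by rewrite sqr_sqrtr// ltW// f0.
rewrite /c; move: (Num.sqrt _) (Num.sqrt _) ((s - t)^-1) => a b d a0 b0.
by field; rewrite !gt_eqF// addr_gt0.
Qed.

(** Mean value theorem on [[a, b]]: the relative derivative is an ordinary one inside, and yields
    continuity up to the endpoints. *)
Lemma deriv_within_eq0_cst (I : interval R) f :
  (forall t, t \in I -> deriv_within [set` I] f t 0) ->
  {in I &, forall a b, f a = f b}.
Proof.
move=> f0 a b; wlog ab : a b / a < b => [wlg aI bI|aI bI].
  by case: (ltgtP a b) => [ab|ba|->//]; [|symmetry]; exact: wlg.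
have subI c : c \in `[a, b] -> c \in I.
  by rewrite in_itv => acb; exact: (interval_is_interval aI bI).
have drv c : c \in `]a, b[ -> is_derive c 1 f 0.
  move=> cab; have cI : c \in I by apply: subI; exact: subset_itv_oo_cc.
  suff : h^-1 *: (f (h *: (1 : R) + c) - f c) @[h --> 0^'] --> (0 : R).
    by move=> fc; apply: DeriveDef; [apply/cvg_ex; exists 0; exact: fc|exact/(cvg_lim _ fc)/norm_hausdorff].
  have fc := f0 _ cI; apply/cvgrPdist_lt => e e0.
  move/cvgrPdist_lt : fc => /(_ _ e0); rewrite !near_withinE near_simpl => fc.
  (* Shrinking the neighbourhood of [c] into []a, b[] makes membership in [I] automatic, so the
     limit becomes two-sided. *)
  have := filterI fc (near_in_itvoo cab) => -[d /= d0 dP]; exists d => //= h.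
  rewrite /= !sub0r !normrN scaler1 => hd h0.
  have := dP (h + c); rewrite /= opprD addrCA subrr addr0 normrN sub0r normrN => /(_ hd)[+ hI].
  rewrite addrK; apply; last by apply/subI/subset_itv_oo_cc.
  by rewrite -subr_eq0 addrK.
have ctn : {within `[a, b], continuous f}.
  apply/subspace_continuousP => c cab.
  have := deriv_within_cvg (f0 _ (subI _ cab)).
  move=> fc; apply/cvgrPdist_lt => e e0.
  move/cvgrPdist_lt : fc => /(_ _ e0); rewrite !near_withinE => fc.
  apply: filterS fc => s fs sab.
  (* Continuity uses full neighbourhoods of [c], while [fc] speaks of punctured ones. *)
  have [->|sc] := eqVneq s c; first by rewrite subrr normr0.
  by apply: fs => //; exact: subI.
have [c _ /eqP] := MVT ab drv ctn.
by rewrite mul0r subr_eq0 => /eqP.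
Qed.

End deriv_within.

(** * Inner product, cross product and Euclidean norm in dimension three *)

Section euclidean.
Variable R : realType.
Implicit Types (u v w n e P Q F : 'rV[R]_3) (k : R).

(** The list lookup computes at 0, 1 and 2, so vector identities reduce to polynomial ones for
    [ring]. *)
Definition cross u w : 'rV[R]_3 :=
  \row_(j < 3) [:: u ord0 1 * w ord0 2 - u ord0 2 * w ord0 1;
                   u ord0 2 * w ord0 0 - u ord0 0 * w ord0 2;
                   u ord0 0 * w ord0 1 - u ord0 1 * w ord0 0]`_j.

Lemma edotE u w :
  edot u w = u ord0 0 * w ord0 0 + u ord0 1 * w ord0 1 + u ord0 2 * w ord0 2.
Proof.
rewrite /edot !big_ord_recl big_ord0 addr0 addrA.
have -> : lift ord0 (ord0 : 'I_2) = 1 :> 'I_3 by exact: val_inj.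
by have -> : lift ord0 (lift ord0 (ord0 : 'I_1)) = 2 :> 'I_3 by exact: val_inj.
Qed.

Lemma row3P u w : u ord0 0 = w ord0 0 -> u ord0 1 = w ord0 1 ->
  u ord0 2 = w ord0 2 -> u = w.
Proof.
move=> uw0 uw1 uw2; apply/rowP => -[[|[|[|//]]] i3].
- by rewrite (_ : Ordinal i3 = 0)//; exact: val_inj.
- by rewrite (_ : Ordinal i3 = 1)//; exact: val_inj.
- by rewrite (_ : Ordinal i3 = 2)//; exact: val_inj.
Qed.

Lemma edotC u w : edot u w = edot w u.
Proof. by rewrite !edotE; ring. Qed.

Lemma edotDl u v w : edot (u + v) w = edot u w + edot v w.
Proof. by rewrite !edotE !mxE; ring. Qed.

Lemma edotZl k u w : edot (k *: u) w = k * edot u w.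
Proof. by rewrite !edotE !mxE; ring. Qed.

Lemma edotNl u w : edot (- u) w = - edot u w.
Proof. by rewrite !edotE !mxE; ring. Qed.

Lemma edotDr u v w : edot w (u + v) = edot w u + edot w v.
Proof. by rewrite !edotE !mxE; ring. Qed.

Lemma edotZr k u w : edot w (k *: u) = k * edot w u.
Proof. by rewrite !edotE !mxE; ring. Qed.

Lemma edotNr u w : edot w (- u) = - edot w u.
Proof. by rewrite !edotE !mxE; ring. Qed.

Definition edot_linear :=
  (edotDl, edotDr, edotNl, edotNr, edotZl, edotZr).

Lemma edot_crossl u w : edot u (cross u w) = 0.
Proof. by rewrite !edotE !mxE /=; ring. Qed.

Lemma edot_crossr u w : edot w (cross u w) = 0.
Proof. by rewrite !edotE !mxE /=; ring. Qed.

Lemma edot_crossC u v w : edot u (cross v w) = edot (cross u v) w.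
Proof. by rewrite !edotE !mxE /=; ring. Qed.

Lemma cross_cross u v w :
  cross u (cross v w) = edot u w *: v - edot u v *: w.
Proof. by apply: row3P; rewrite !edotE !mxE /=; ring. Qed.

Lemma lagrange_identity u w :
  edot (cross u w) (cross u w) = edot u u * edot w w - edot u w ^+ 2.
Proof. by rewrite !edotE !mxE /=; ring. Qed.

Lemma edot_ge0 u : 0 <= edot u u.
Proof. by rewrite edotE -!expr2 !addr_ge0 ?sqr_ge0. Qed.

Lemma edot_eq0 u : (edot u u == 0) = (u == 0).
Proof.
apply/eqP/eqP => [|->]; last by rewrite edotE !mxE; ring.
rewrite edotE -!expr2 => /eqP.
rewrite !paddr_eq0 ?addr_ge0 ?sqr_ge0// !sqrf_eq0 => /andP[/andP[]].
by move=> /eqP u0 /eqP u1 /eqP u2; apply: row3P; rewrite mxE.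
Qed.

Lemma edot_gt0 u : (0 < edot u u) = (u != 0).
Proof. by rewrite lt_def edot_ge0 andbT edot_eq0. Qed.

Lemma enorm_ge0 u : 0 <= enorm u.
Proof. exact: sqrtr_ge0. Qed.

Lemma enorm_sqr u : enorm u ^+ 2 = edot u u.
Proof. by rewrite sqr_sqrtr ?edot_ge0. Qed.

Lemma enorm_gt0 u : (0 < enorm u) = (u != 0).
Proof. by rewrite sqrtr_gt0 edot_gt0. Qed.

Lemma enorm_eq u k : 0 <= k -> edot u u = k ^+ 2 -> enorm u = k.
Proof. by move=> k0 uk; rewrite /enorm uk sqrtr_sqr ger0_norm. Qed.

Lemma enormZ k u : enorm (k *: u) = `|k| * enorm u.
Proof.
apply: enorm_eq; first by rewrite mulr_ge0// enorm_ge0.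
by rewrite !edot_linear exprMn enorm_sqr -normrX ger0_norm ?sqr_ge0//; ring.
Qed.

(** By the Lagrange identity the difference of the squares is |u × w|^2. *)
Lemma cauchy_schwarz u w : `|edot u w| <= enorm u * enorm w.
Proof.
rewrite -ler_sqr ?nnegrE ?mulr_ge0 ?enorm_ge0// -normrX ger0_norm ?sqr_ge0//.
rewrite exprMn !enorm_sqr -subr_ge0 -lagrange_identity; exact: edot_ge0.
Qed.

(** Expanding u × (u × w) = 0 gives (u·w) u = (u·u) w, which is solved for w. *)
Lemma cross_eq0_parallel u w : u != 0 -> cross u w = 0 -> parallel w u.
Proof.
move=> u0 uw0; exists (edot u w / edot u u).
have := cross_cross u u w; rewrite uw0.
have -> : cross u 0 = 0 by apply: row3P; rewrite !mxE /=; ring.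
move/esym/eqP; rewrite subr_eq0 => /eqP uw.
by rewrite mulrC -scalerA uw scalerA mulVf ?scale1r// edot_eq0.
Qed.

End euclidean.

(** * Coordinatewise derivatives of vector functions *)

Section vector_deriv_within.
Variable R : realType.
Implicit Types (I : set R) (f g : R -> 'rV[R]_3) (h : R -> R) (t c : R).
Implicit Types k l : 'rV[R]_3.

Definition coord_deriv_within I f t l : Prop :=
  forall i, deriv_within I (fun s => f s ord0 i) t (l ord0 i).

Lemma coord_deriv_withinB I f g t k l :
  coord_deriv_within I f t k -> coord_deriv_within I g t l ->
  coord_deriv_within I (fun s => f s - g s) t (k - l).
Proof.
move=> fk gl i.
by apply: (eq_deriv_within _ _ (deriv_withinB (fk i) (gl i))) => [s|]; rewrite !mxE.
Qed.

Lemma coord_deriv_withinZ I h f t c l :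
  deriv_within I h t c -> coord_deriv_within I f t l ->
  coord_deriv_within I (fun s => h s *: f s) t (c *: f t + h t *: l).
Proof.
move=> hc fl i.
by apply: (eq_deriv_within _ _ (deriv_withinM hc (fl i))) => [s|]; rewrite !mxE.
Qed.

Lemma coord_deriv_within_cst I k t : coord_deriv_within I (fun=> k) t 0.
Proof. by move=> i; rewrite mxE; exact: deriv_within_cst. Qed.

Lemma coord_deriv_within_cross I f g t k l :
  coord_deriv_within I f t k -> coord_deriv_within I g t l ->
  coord_deriv_within I (fun s => cross (f s) (g s)) t
    (cross k (g t) + cross (f t) l).
Proof.
move=> fk gl [[|[|[|//]]] i3].
- apply: (eq_deriv_within _ _ (deriv_withinB (deriv_withinM (fk 1) (gl 2))
    (deriv_withinM (fk 2) (gl 1)))) => [s|]; rewrite !mxE /=; ring.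
- apply: (eq_deriv_within _ _ (deriv_withinB (deriv_withinM (fk 2) (gl 0))
    (deriv_withinM (fk 0) (gl 2)))) => [s|]; rewrite !mxE /=; ring.
- apply: (eq_deriv_within _ _ (deriv_withinB (deriv_withinM (fk 0) (gl 1))
    (deriv_withinM (fk 1) (gl 0)))) => [s|]; rewrite !mxE /=; ring.
Qed.

Lemma deriv_within_edot I f g t k l :
  coord_deriv_within I f t k -> coord_deriv_within I g t l ->
  deriv_within I (fun s => edot (f s) (g s)) t (edot k (g t) + edot (f t) l).
Proof.
move=> fk gl.
apply: (eq_deriv_within _ _ (deriv_withinD (deriv_withinD
  (deriv_withinM (fk 0) (gl 0)) (deriv_withinM (fk 1) (gl 1)))
  (deriv_withinM (fk 2) (gl 2)))) => [s|]; rewrite !edotE; ring.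
Qed.

Lemma coord_deriv_within_eq0_cst (I : interval R) f :
  (forall t, t \in I -> coord_deriv_within [set` I] f t 0) ->
  {in I &, forall a b, f a = f b}.
Proof.
move=> f0 a b aI bI; apply/rowP => i.
apply: (deriv_within_eq0_cst (f := fun s => f s ord0 i) _ aI bI) => t tI.
by have := f0 _ tI i; rewrite mxE.
Qed.

End vector_deriv_within.

(** * From the focal equation |r| + e·r = p to the three kinds of conics *)

Section conics.
Variable R : realType.
Implicit Types (S L e P : 'rV[R]_3) (p : R).

(** With r = P - S, substituting e·r = p - |r| and p = a (1 - |e|^2) gives |r + 2ae|^2 = (2a -
    |r|)^2. Extracting the root requires |r| <= 2a. *)
Lemma ellipse_of_focus S L e p : edot L e = 0 -> 0 < p -> edot e e < 1 ->
  let H := [set P | edot L (P - S) = 0] in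
  exists2 C, is_ellipse_in H C &
    forall P, H P -> enorm (P - S) + edot e (P - S) = p -> C P.
Proof.
move=> Le p0 e1 H; pose a := p / (1 - edot e e).
have q0 : 0 < 1 - edot e e by rewrite subr_gt0.
have a0 : 0 < a by exact: divr_gt0.
have pE : p = a * (1 - edot e e) by rewrite divfK// gt_eqF.
clearbody a.
have en1 : enorm e < 1.
  by rewrite -(@ltr_pXn2r _ 2) ?nnegrE ?enorm_ge0// enorm_sqr expr1n.
pose F := S + (- (2 * a)) *: e.
exists [set P | H P /\ enorm (P - S) + enorm (P - F) = 2 * a].
  exists S, F, a; split => //.
  - by rewrite /H /= subrr -(scale0r S) !edot_linear mul0r.
  - by rewrite /H /F /= addrC addKr !edot_linear Le mulr0.
  - rewrite /F opprD addNKr -scaleNr opprK enormZ ger0_norm ?mulr_ge0// ?ltW//.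
    by rewrite gtr_pMr// pmulr_rgt0.
move=> P HP Pp; split => //.
have PF : P - F = (P - S) + (2 * a) *: e by rewrite /F opprD scaleNr opprK addrA.
rewrite PF; move: (P - S) Pp => r rp.
(* Cauchy-Schwarz gives |r| (1 - |e|) <= p = a (1 + |e|) (1 - |e|), so |r| is at most a (1 + |e|),
   the largest distance from the focus. *)
have r2a : enorm r <= 2 * a.
  have := cauchy_schwarz e r; rewrite ler_norml => /andP[+ _].
  have r0 := enorm_ge0 r; have n0 := enorm_ge0 e; have nE := enorm_sqr e.
  move: (enorm r) (enorm e) r0 n0 nE en1 rp => rho n rho0 n0 nE n1 rp er.
  have : rho * (1 - n) <= a * (1 + n) * (1 - n).
    have -> : a * (1 + n) * (1 - n) = p by rewrite pE -nE; ring.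
    lra.
  rewrite ler_pM2r ?subr_gt0// => /le_trans; apply.
  rewrite mulrC ler_pM2r//; lra.
suff -> : enorm (r + (2 * a) *: e) = 2 * a - enorm r by rewrite addrC subrK.
apply: enorm_eq; first by rewrite subr_ge0.
have -> : (2 * a - enorm r) ^+ 2 = 4 * a ^+ 2 - 4 * a * enorm r + enorm r ^+ 2.
  ring.
have er : edot e r = p - enorm r by rewrite -rp; ring.
rewrite enorm_sqr !edot_linear (edotC r e) er pE; ring.
Qed.

(** Here a is the opposite of p / (1 - |e|^2), to be positive, so the second focus is S + 2ae. The
    same substitution gives |r - 2ae| = 2a + |r|: the points lie on the branch closer to S. *)
Lemma hyperbola_of_focus S L e p : edot L e = 0 -> 0 < p -> 1 < edot e e ->
  let H := [set P | edot L (P - S) = 0] in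
  exists2 C, is_hyperbola_in H C &
    forall P, H P -> enorm (P - S) + edot e (P - S) = p -> C P.
Proof.
move=> Le p0 e1 H; pose a := p / (edot e e - 1).
have q0 : 0 < edot e e - 1 by rewrite subr_gt0.
have a0 : 0 < a by exact: divr_gt0.
have pE : p = a * (edot e e - 1) by rewrite divfK// gt_eqF.
clearbody a.
have en1 : 1 < enorm e.
  by rewrite -(@ltr_pXn2r _ 2) ?nnegrE ?enorm_ge0// enorm_sqr expr1n.
pose F := S + (2 * a) *: e.
exists [set P | H P /\ `|enorm (P - S) - enorm (P - F)| = 2 * a].
  exists S, F, a; split => //.
  - by rewrite /H /= subrr -(scale0r S) !edot_linear mul0r.
  - by rewrite /H /F /= addrC addKr !edot_linear Le mulr0.
  - rewrite /F opprD addNKr -scaleNr enormZ normrN ger0_norm ?mulr_ge0// ?ltW//.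
    by rewrite ltr_pMr// pmulr_rgt0.
move=> P HP Pp; split => //.
have PF : P - F = (P - S) - (2 * a) *: e by rewrite /F opprD addrA.
rewrite PF; move: (P - S) Pp => r rp.
suff -> : enorm (r - (2 * a) *: e) = 2 * a + enorm r.
  by rewrite opprD addrCA subrr addr0 normrN ger0_norm// mulr_ge0// ltW.
apply: enorm_eq; first by rewrite addr_ge0 ?enorm_ge0 ?mulr_ge0// ltW.
have -> : (2 * a + enorm r) ^+ 2 = 4 * a ^+ 2 + 4 * a * enorm r + enorm r ^+ 2.
  ring.
have er : edot e r = p - enorm r by rewrite -rp; ring.
rewrite enorm_sqr !edot_linear (edotC r e) er pE; ring.
Qed.

(** The vectors e and u = L × e are orthogonal and span the directions of the plane. The component
    of P - A along the unit vector e is e·r - p = -|r|, so P is at distance |r| from the line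
    through A directed by u. *)
Lemma parabola_of_focus S L e p :
  L != 0 -> edot L e = 0 -> 0 < p -> edot e e = 1 ->
  let H := [set P | edot L (P - S) = 0] in
  exists2 C, is_parabola_in H C &
    forall P, H P -> enorm (P - S) + edot e (P - S) = p -> C P.
Proof.
move=> L0 Le p0 e1 H; pose u := cross L e; pose A := S + p *: e.
have uu : edot u u = edot L L.
  by rewrite lagrange_identity e1 Le expr0n /= subr0 mulr1.
have u0 : u != 0 by rewrite -edot_eq0 uu edot_eq0.
have eu : edot e u = 0 by exact: edot_crossr.
have Lu : edot L u = 0 by exact: edot_crossl.
have DS k : A + k *: u - S = p *: e + k *: u.
  by rewrite addrC /A !addrA addNr add0r.
pose D := [set A + k *: u | k in [set: R]].
exists [set P | H P /\ enorm (P - S) = edist_set P D].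
  exists S, D; split => //.
  - by rewrite /H /= subrr -(scale0r S) !edot_linear mul0r.
  - by exists A, u.
  - move=> _ [k _ <-]; rewrite /H /= DS !edot_linear Le Lu.
    by rewrite !mulr0 addr0.
  (* The functional e·(P - S) equals p on the directrix and 0 at S. *)
  - move=> [k _] /(congr1 (fun P => edot e (P - S))).
    rewrite /= DS subrr -(scale0r S) !edot_linear e1 eu.
    by rewrite mulr0 addr0 mulr1 mul0r => pe; rewrite pe ltxx in p0.
move=> P HP Pp; split => //.
have PD k : P - (A + k *: u) = (P - S - p *: e) - k *: u.
  by rewrite /A !opprD !addrA.
have edist : edot e (P - S - p *: e) = - enorm (P - S).
  by rewrite edotDr edotNr edotZr e1 -Pp; ring.
have LPD : edot L (P - S - p *: e) = 0.
  by rewrite edotDr edotNr edotZr Le HP mulr0 subrr.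
rewrite /edist_set; set E := [set _ | _ in _].
(* Every w - k u has the same component -|r| along the unit vector e, so its norm is at least
   |r|. *)
have lbE : lbound E (enorm (P - S)).
  move=> _ [_ [k _ <-] <-]; rewrite PD.
  move: (P - S - p *: e) edist => w ew.
  have := cauchy_schwarz e (w - k *: u).
  rewrite edotDr edotNr edotZr eu mulr0 subr0 ew normrN ger0_norm ?enorm_ge0//.
  by rewrite (@enorm_eq _ e 1)// ?mul1r// e1 expr1n.
(* The bound is attained at the foot of the perpendicular from P, which determines [k]; what remains
   of w is its component along e. *)
have inE : E (enorm (P - S)).
  pose w := P - S - p *: e; pose k := edot w u / edot u u.
  exists (A + k *: u); first by exists k.
  apply: enorm_eq; rewrite ?enorm_ge0// PD -/w.
  (* In the plane orthogonal to [L], [e] and [u = L × e] are orthogonal. *)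
  have wu : edot w w * edot u u = edot w e ^+ 2 * edot u u + edot w u ^+ 2.
    have := lagrange_identity w u; rewrite /u cross_cross -/u (edotC w L) LPD.
    rewrite scale0r subr0 !edot_linear -uu => eq.
    by apply/eqP; rewrite -subr_eq -eq; apply/eqP; ring.
  rewrite -[RHS]sqrrN -edist -/w; clearbody w.
  rewrite !edot_linear (edotC u w) (edotC e w).
  apply: (mulIf (x := edot u u)); first by rewrite edot_eq0.
  rewrite mulrDl.
  have kE : k * edot u u = edot w u by rewrite divfK// edot_eq0.
  have -> : edot w e ^+ 2 * edot u u = edot w w * edot u u - edot w u ^+ 2.
    by rewrite wu; ring.
  rewrite -kE; ring.
apply/eqP; rewrite eq_le; apply/andP; split.
  by apply: lb_le_inf => //; exists (enorm (P - S)).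
by apply: ge_inf => //; exists (enorm (P - S)).
Qed.

Lemma conic_of_focus S L e p : L != 0 -> edot L e = 0 -> 0 < p ->
  let H := [set P | edot L (P - S) = 0] in
  exists2 C, is_conic_in H C &
    forall P, H P -> enorm (P - S) + edot e (P - S) = p -> C P.
Proof.
move=> L0 Le p0 H; case: (ltgtP (edot e e) 1) => e1.
- have [C HC PC] := ellipse_of_focus S Le p0 e1.
  by exists C => //; exact: Or31.
- have [C HC PC] := hyperbola_of_focus S Le p0 e1.
  by exists C => //; exact: Or33.
- have [C HC PC] := parabola_of_focus S L0 Le p0 e1.
  by exists C => //; exact: Or32.
Qed.

End conics.

(** * Conserved vectors of the motion and the orbit *)

Theorem theorem12 (R : realType) (S : 'rV[R]_3) (m : R) (I : interval R)
    (x x' x'' : R -> 'rV[R]_3) (t0 : R)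
    (m_gt0 : 0 < m)
    (x_neqS : forall t : R, t \in I -> x t != S)
    (x_deriv : forall t : R, t \in I -> has_deriv_within [set` I] x t (x' t))
    (x'_deriv : forall t : R, t \in I -> has_deriv_within [set` I] x' t (x'' t))
    (inverse_square : forall t : R, t \in I ->
       x'' t = - (m *: ((enorm (x t - S) ^+ 3)^-1 *: (x t - S))))
    (t0I : t0 \in I)
    (v0_neq0 : x' t0 != 0)
    (v0_nparallel : ~ parallel (x' t0) (x t0 - S)) :
  exists H C : set 'rV[R]_3,
    [/\ is_plane H, is_conic_in H C & forall t : R, t \in I -> C (x t)].
Proof.
pose r t := x t - S; pose L := cross (r t0) (x' t0).
have r_neq0 t : t \in I -> r t != 0 by move=> tI; rewrite subr_eq0 x_neqS.
have r_deriv t : t \in I -> coord_deriv_within [set` I] r t (x' t).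
  move=> tI; rewrite -[x' t]subr0; apply: coord_deriv_withinB.
    by move=> i; exact/has_deriv_within_coord/x_deriv.
  exact: coord_deriv_within_cst.
have v_deriv t : t \in I -> coord_deriv_within [set` I] x' t
    (- (m *: ((enorm (r t) ^+ 3)^-1 *: r t))).
  by move=> tI i; rewrite -inverse_square//; exact/has_deriv_within_coord/x'_deriv.
(* The derivative is x' × x' + r × x'', and both terms vanish since the force is central. *)
have momentum t : t \in I -> cross (r t) (x' t) = L.
  move=> tI; apply: (coord_deriv_within_eq0_cst
    (f := fun s => cross (r s) (x' s)) _ tI t0I) => {t tI} t tI.
  have := coord_deriv_within_cross (r_deriv t tI) (v_deriv t tI).
  by congr coord_deriv_within; apply: row3P; rewrite !mxE /=; ring.
pose lrl t := cross (x' t) L - m *: ((enorm (r t))^-1 *: r t).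
(* With r × L = (r·x') r - |r|^2 x', the vector x'' × L equals m (x'/|r| - (r·x') r/|r|^3), which is
   the derivative of m r/|r|. *)
have lrl_cst t : t \in I -> lrl t = lrl t0.
  move=> tI; apply: (coord_deriv_within_eq0_cst (f := lrl) _ tI t0I).
  move=> {t tI} t tI.
  have rr_deriv := deriv_within_edot (r_deriv t tI) (r_deriv t tI).
  (* [edot_gt0] is an equality of booleans and [r_neq0] an equality with [true]; [etrans] composes
     them into positivity of r·r. *)
  have n_deriv := deriv_within_sqrtV (f := fun s => edot (r s) (r s)) tI
    (fun s sI => etrans (edot_gt0 _) (r_neq0 s sI)) rr_deriv.
  have := coord_deriv_withinB
    (coord_deriv_within_cross (v_deriv t tI) (coord_deriv_within_cst _ L t))
    (coord_deriv_withinZ (deriv_within_cst _ m t)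
      (coord_deriv_withinZ n_deriv (r_deriv t tI))).
  congr coord_deriv_within; rewrite -/(enorm (r t)).
  have n_neq0 : enorm (r t) != 0 by rewrite gt_eqF// enorm_gt0 r_neq0.
  have LE : cross (r t) L = edot (r t) (x' t) *: r t - enorm (r t) ^+ 2 *: x' t.
    by rewrite -(momentum t tI) cross_cross enorm_sqr.
  have crossZ k u w : cross (k *: u) w = k *: cross u w.
    by apply: row3P; rewrite !mxE /=; ring.
  rewrite -scaleNr !crossZ LE (edotC (x' t)).
  move: (edot _ _) (enorm _) n_neq0 => d n n_neq0.
  have cross0 w : cross w 0 = 0 by apply: row3P; rewrite !mxE /=; ring.
  by rewrite cross0; apply/rowP => i; rewrite !mxE; field.
have L_neq0 : L != 0.
  apply/eqP => L0; apply: v0_nparallel.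
  exact: cross_eq0_parallel (r_neq0 _ t0I) L0.
have m_neq0 : m != 0 by rewrite gt_eqF.
pose e := m^-1 *: lrl t0.
have Lr t : t \in I -> edot L (r t) = 0.
  by move=> tI; rewrite -(momentum t tI) edotC edot_crossl.
have Le : edot L e = 0.
  by rewrite /e /lrl edotZr edotDr edotNr !edotZr edot_crossr Lr//; ring.
have p_gt0 : 0 < edot L L / m by rewrite divr_gt0// edot_gt0.
have [C HC PC] := conic_of_focus S L_neq0 Le p_gt0.
exists [set P | edot L (P - S) = 0], C; split => //; first by exists S, L.
move=> t tI; apply: PC; first exact: Lr.
(* Evaluating the constant vector at time [t], the triple product r·(x' × L) = (r × x')·L = |L|^2
   gives m e·r = |L|^2 - m |r|. *)
rewrite -/(r t) /e -(lrl_cst t tI) /lrl edotZl edotDl edotNl !edotZl.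
rewrite (edotC _ (r t)) edot_crossC (momentum t tI) -(enorm_sqr (r t)).
have : enorm (r t) != 0 by rewrite gt_eqF// enorm_gt0 r_neq0.
by move=> n_neq0; field; rewrite m_neq0.
Qed.
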